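(* The communication complexity of constructing a $+2$-spanner of an unweighted undirected distributed graph on $n$ vertices with edges observed at $s$ sites in the blackboard model, with or without duplication, is $\tilde{O}(s+n\sqrt{n+s})$.
   Context: Distributed graph: there are $s$ sites $S_1,\dots,S_s$ with a common vertex set $V$, $|V|=n$; site $S_i$ holds a subset $E_i\subseteq E$ of the edges of an undirected graph $G=(V,E)$, where $E=\bigcup_{i=1}^s E_i$. Without duplication, the sets $E_i$ are pairwise disjoint; with duplication, they may have non-empty intersections. Blackboard model: sites communicate with each other through a shared blackboard (such as a broadcast channel), whose contents are visible to all; a coordinator outputs the result. The communication cost is the total number of bits communicated; the communication complexity of a problem is the communication cost needed to solve it. Spanner: a $+\beta$-spanner of $G$ is a subgraph $H=(V,E')$, $E'\subseteq E$, with $d_H(u,v)\le d_G(u,v)+\beta$ for all $u,v\in V$, where $d$ denotes shortest-path distance. $\tilde{O}$ hides a polylogarithmic factor. *)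

(* Defs.v *)
From mathcomp Require Import all_boot all_order all_algebra.
From mathcomp Require Import all_classical all_reals all_analysis.

Set Implicit Arguments.
Unset Strict Implicit.
Unset Printing Implicit Defensive.

Import Order.TTheory GRing.Theory Num.Theory.
Local Open Scope ring_scope.

(* An edge is an unordered pair of distinct vertices, i.e. a two-element set. *)
Definition edge_set (n : nat) := {set {set 'I_n}}.

Definition simple_edges (n : nat) (E : edge_set n) : Prop :=
  forall e, e \in E -> #|e| = 2%N.

Definition adj (n : nat) (E : edge_set n) : rel 'I_n :=
  fun u v => [set u; v]%SET \in E.

(* Shortest-path distance; the infimum of the empty set is +oo, so vertices in
   different components are at infinite distance. *)
Definition dist (R : realType) (n : nat) (E : edge_set n) (u v : 'I_n) :
    \bar R :=
  ereal_inf [set ((size p)%:R)%:E | p in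
    [set p : seq 'I_n | path (adj E) u p /\ last u p = v]]%classic.

Definition additive_spanner (R : realType) (beta n : nat) (E H : edge_set n) :
    Prop :=
  H \subset E /\
  forall u v : 'I_n, (dist R H u v <= dist R E u v + (beta%:R)%:E)%E.

Definition distributed_input (n s : nat) := 'I_s -> edge_set n.

Definition union_graph (n s : nat) (x : distributed_input n s) : edge_set n :=
  (\bigcup_(i < s) x i)%SET.

Definition valid_input (dup : bool) (n s : nat) (x : distributed_input n s) :
    Prop :=
  (forall i, simple_edges (x i)) /\
  (~~ dup -> forall i j, i != j -> [disjoint x i & x j]).

(* Deterministic blackboard protocols as protocol trees.  A node is a content
   of the blackboard: that content alone determines which site writes the next
   bit, and the bit depends only on that content and on the writer's own edges.
   At a leaf the coordinator, who holds no edges, outputs an edge set. *)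
Inductive protocol (n s : nat) : Type :=
| Output of edge_set n
| Write (i : 'I_s) (bit : edge_set n -> bool) (next : bool -> protocol n s).

Fixpoint blackboard (n s : nat) (P : protocol n s)
    (x : distributed_input n s) : seq bool :=
  match P with
  | Output _ => [::]
  | Write i bit next => bit (x i) :: blackboard (next (bit (x i))) x
  end.

Fixpoint output (n s : nat) (P : protocol n s) (x : distributed_input n s) :
    edge_set n :=
  match P with
  | Output H => H
  | Write i bit next => output (next (bit (x i))) x
  end.

Definition solves_spanner (R : realType) (beta : nat) (dup : bool) (n s : nat)
    (P : protocol n s) : Prop :=
  forall x, valid_input dup x ->
    additive_spanner R beta (union_graph x) (output P x).

Definition worst_case_cost_le (dup : bool) (n s : nat) (P : protocol n s)
    (c : nat) : Prop :=
  forall x, valid_input dup x -> (size (blackboard P x) <= c)%N.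

Definition spanner_complexity (R : realType) (beta : nat) (dup : bool)
    (n s : nat) : \bar R :=
  ereal_inf [set (c%:R)%:E | c in
    [set c : nat | exists P : protocol n s,
       solves_spanner R beta dup P /\ worst_case_cost_le dup P c]]%classic.

(* f = O~(g) for functions of (n, s): f <= C * g * log^k g.  The shift by 2
   keeps the logarithm bounded away from 0, so that the bound can be required
   for all n and s. *)
Definition soft_O (R : realType) (f : nat -> nat -> \bar R)
    (g : nat -> nat -> R) : Prop :=
  exists (C : R) (k : nat), forall n s : nat,
    (f n s <= (C * g n s * ln (g n s + 2) ^+ k)%:E)%E.

(* Main.v *)
(* Put d ~ sqrt(n + s).  The sites first post, in turn, every edge with an
   endpoint of posted degree below d: at most n * d edges.  All other edges join
   vertices of posted degree at least d, and O(n log n / d) centers dominate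
   these vertices through posted edges.  The sites then run breadth-first
   searches from all centers in parallel.  A level without vertices of high
   degree is left by posted edges only, so it needs no communication; since each
   other level accounts for d vertices within one hop, O(n / d) rounds of s
   messages suffice, plus one posted edge per pair (center, vertex).  Finally, a
   shortest path that uses an unposted edge passes through a vertex adjacent to a
   center, and the detour through the center costs at most 2. *)
Require Import Defs.
From mathcomp Require Import all_boot all_order all_algebra.
From mathcomp Require Import all_classical all_reals all_analysis.
From mathcomp Require Import fintype finset zify ring lra.

Set Implicit Arguments.
Unset Strict Implicit.
Unset Printing Implicit Defensive.

Import Order.TTheory GRing.Theory Num.Theory.

Local Open Scope nat_scope.

(** * Neighbourhoods, balls and paths *)

Definition nbr (n : nat) (E : edge_set n) (v : 'I_n) : {set 'I_n} :=
  [set w | adj E v w]%SET.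

(** The strict inequality makes the ball of radius 0 empty, so a search can start from a claim about
    radius 0 that holds vacuously. *)
Definition hop_ball (n : nat) (E : edge_set n) (c : 'I_n) (k : nat) : {set 'I_n} :=
  [set v | `[< exists p, [/\ path (adj E) c p, last c p = v & size p < k] >]]%SET.

Lemma adjC (n : nat) (E : edge_set n) (u v : 'I_n) : adj E u v = adj E v u.
Proof. by rewrite /adj setUC. Qed.

Lemma adjS (n : nat) (E E' : edge_set n) (u v : 'I_n) :
  E \subset E' -> adj E u v -> adj E' u v.
Proof. by move=> /subsetP; apply. Qed.

Lemma hop_ballP (n : nat) (E : edge_set n) (c v : 'I_n) (k : nat) :
  reflect (exists p, [/\ path (adj E) c p, last c p = v & size p < k])
          (v \in hop_ball E c k).
Proof. by rewrite inE; exact: asboolP. Qed.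

Lemma hop_ball0 (n : nat) (E : edge_set n) (c : 'I_n) : hop_ball E c 0 = set0.
Proof. by apply/setP => v; rewrite in_set0; apply/hop_ballP => -[p []]. Qed.

Lemma hop_ball_center (n : nat) (E : edge_set n) (c : 'I_n) (k : nat) :
  c \in hop_ball E c k.+1.
Proof. by apply/hop_ballP; exists [::]. Qed.

Lemma hop_ball_subgraph (n : nat) (E E' : edge_set n) (c : 'I_n) (k : nat) :
  E \subset E' -> hop_ball E c k \subset hop_ball E' c k.
Proof.
move=> sEE'; apply/subsetP => v /hop_ballP[p [pp lp sp]]; apply/hop_ballP.
by exists p; split=> //; apply: sub_path pp => a b; exact: adjS.
Qed.

Lemma hop_ball_mono (n : nat) (E : edge_set n) (c : 'I_n) (j k : nat) :
  j <= k -> hop_ball E c j \subset hop_ball E c k.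
Proof.
move=> jk; apply/subsetP => v /hop_ballP[p [pp lp sp]]; apply/hop_ballP.
by exists p; split=> //; exact: leq_trans jk.
Qed.

Lemma hop_ball_adj (n : nat) (E : edge_set n) (c u v : 'I_n) (k : nat) :
  u \in hop_ball E c k -> adj E u v -> v \in hop_ball E c k.+1.
Proof.
move=> /hop_ballP[p [pp lp sp]] uv; apply/hop_ballP; exists (rcons p v).
by rewrite rcons_path pp lp uv last_rcons size_rcons.
Qed.

Lemma hop_ball_succ (n : nat) (E : edge_set n) (c v : 'I_n) (k : nat) :
  v \in hop_ball E c k.+1 -> v = c \/ exists2 u, u \in hop_ball E c k & adj E u v.
Proof.
move=> /hop_ballP[p]; case/lastP: p => [|p w] [/= pp lp sp]; first by left.
right; move: pp lp sp; rewrite rcons_path last_rcons size_rcons ltnS.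
by move=> /andP[pp ew] <- sp; exists (last c p) => //; apply/hop_ballP; exists p.
Qed.

Lemma path_adj_rev (n : nat) (E : edge_set n) (u : 'I_n) (p : seq 'I_n) :
  path (adj E) u p ->
  exists q, [/\ path (adj E) (last u p) q, last (last u p) q = u
              & size q = size p].
Proof.
move=> pp; exists (rev (belast u p)); split.
- by rewrite rev_path (eq_path (e' := adj E)) // => a b; rewrite adjC.
- by case: p {pp} => //= a p; rewrite rev_cons last_rcons.
- by rewrite size_rev size_belast.
Qed.

(** * Messages and rounds of posting on the blackboard *)

Lemma send_bits (n s m : nat) (i : 'I_s) (f : edge_set n -> seq bool)
    (next : seq bool -> protocol n s) :
  (forall E, size (f E) = m) ->
  exists P : protocol n s, forall x,
    output P x = output (next (f (x i))) x /\
    size (blackboard P x) = m + size (blackboard (next (f (x i))) x).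
Proof.
elim: m f next => [|m IH] f next sf.
  exists (next [::]) => x.
  by rewrite (size0nil (sf (x i))).
have {}IH b := IH (fun E => behead (f E)) (fun l => next (b :: l)).
have /choice[Q HQ] b := IH b (fun E => etrans (size_behead _) (congr1 predn (sf E))).
exists (Write i (fun E => head false (f E)) Q) => x /=.
have [-> ->] := HQ (head false (f (x i))) x.
by have := sf (x i); case: (f (x i)) => //= b l _; rewrite addSn.
Qed.

Lemma send (n s m : nat) (T : finType) (i : 'I_s) (f : edge_set n -> T)
    (next : T -> protocol n s) :
  #|T| <= 2 ^ m ->
  exists P : protocol n s, forall x,
    output P x = output (next (f (x i))) x /\
    size (blackboard P x) = m + size (blackboard (next (f (x i))) x).
Proof.
move=> Tm.
have Tm' : #|T| <= #|{: m.-tuple bool}| by rewrite card_tuple card_bool.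
pose code (t : T) : m.-tuple bool := enum_val (widen_ord Tm' (enum_rank t)).
have code_inj : injective code.
  move=> t u /enum_val_inj /(congr1 val) /= tu.
  by apply/enum_rank_inj/val_inj.
(* Only codewords are ever written, so the default output is arbitrary. *)
pose next' (l : seq bool) :=
  if [pick t | (code t : seq bool) == l] is Some t then next t else Output s set0.
have [P HP] := @send_bits n s m i (fun E => code (f E)) next'
   (fun E => size_tuple _).
exists P => x; have [-> ->] := HP x; rewrite /next'.
case: pickP => [t /eqP/val_inj/code_inj -> //|/(_ (f (x i)))].
by rewrite eqxx.
Qed.

(* The sites speak in turn, each posting its wanted edges one at a time and then
   passing.  [Phi] pays for the posted edges. *)
Lemma auction (n s m : nat) (want : edge_set n -> {set 'I_n} -> bool)
    (Phi : edge_set n -> nat) (K0 : edge_set n)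
    (next : edge_set n -> protocol n s) :
  n * n < 2 ^ m ->
  (forall (K : edge_set n) (e : {set 'I_n}), K0 \subset K ->
     #|e| = 2 -> want K e -> Phi (e |: K) < Phi K) ->
  (forall (K K' : edge_set n) (e : {set 'I_n}), K \subset K' -> want K' e -> want K e) ->
  exists P : protocol n s, forall x, (forall i, simple_edges (x i)) ->
    exists K : edge_set n, [/\ K0 \subset K, K \subset K0 :|: union_graph x,
      forall e, e \in union_graph x -> ~~ want K e,
      output P x = output (next K) x
      & size (blackboard P x) + m * Phi K
          <= m * (s + Phi K0) + size (blackboard (next K) x)].
Proof.
move=> nm PhiD wantS.
(* Each message either removes a site from the list [r] of remaining speakers or lowers the
   potential, hence the induction on a bound of their sum. *)
suff main N (r : seq 'I_s) (K1 : edge_set n) : K0 \subset K1 ->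
    size r + Phi K1 <= N ->
    exists P : protocol n s, forall x, (forall i, simple_edges (x i)) ->
    exists K : edge_set n, [/\ K1 \subset K, K \subset K1 :|: union_graph x,
      forall i e, i \in r -> e \in x i -> ~~ want K e,
      output P x = output (next K) x
      & size (blackboard P x) + m * Phi K
          <= m * (size r + Phi K1) + size (blackboard (next K) x)].
  have [P HP] := main _ (enum 'I_s) K0 (subxx _) (leqnn _).
  exists P => x sx; have [K [K0K KG Kw oP bP]] := HP x sx.
  exists K; split=> //; last by rewrite size_enum_ord in bP.
  by move=> e /bigcupP[i _ ei]; apply: Kw ei; rewrite mem_enum.
elim: N r K1 => [|N IH] [|i r] K1 K01 //= leN.
- by exists (next K1) => x sx; exists K1; split=> //=; rewrite ?subsetUl // addnC.
- by exists (next K1) => x sx; exists K1; split=> //=; rewrite ?subsetUl // addnC.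
pose edge (p : 'I_n * 'I_n) := [set p.1; p.2].
pose ok (p : 'I_n * 'I_n) := (p.1 != p.2) && want K1 (edge p).
have card_edge p : ok p -> #|edge p| = 2 by case/andP=> p12 _; rewrite cards2 p12.
(* A continuation is needed for every possible message; pairs that are not [ok] are never sent and
   get a dummy one. *)
have /choice[Q HQ] (o : option ('I_n * 'I_n)) : exists P : protocol n s,
    match o with
    | Some p => ok p -> forall x, (forall i, simple_edges (x i)) ->
       exists K : edge_set n, [/\ edge p |: K1 \subset K,
         K \subset edge p |: K1 :|: union_graph x,
         forall j e, j \in i :: r -> e \in x j -> ~~ want K e,
         output P x = output (next K) x
         & size (blackboard P x) + m * Phi K
          <= m * (size (i :: r) + Phi (edge p |: K1))
             + size (blackboard (next K) x)]
    | None => forall x, (forall i, simple_edges (x i)) ->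
       exists K : edge_set n, [/\ K1 \subset K, K \subset K1 :|: union_graph x,
         forall j e, j \in r -> e \in x j -> ~~ want K e,
         output P x = output (next K) x
         & size (blackboard P x) + m * Phi K
          <= m * (size r + Phi K1) + size (blackboard (next K) x)]
    end.
  case: o => [p|]; last by apply: IH => //; lia.
  have [okp|nokp] := boolP (ok p); last by exists (Output s set0).
  have [||P HP] := IH (i :: r) (edge p |: K1).
  - exact: subset_trans K01 (subsetUr _ _).
  - have := PhiD K1 _ K01 (card_edge _ okp) (proj2 (andP okp)).
    by move: leN; rewrite -[size (i :: r)]/((size r).+1);
      set A := Phi _; set B := Phi _; lia.
  by exists P.
(* A message is a pair of vertices or a pass, so there are [n * n + 1] of them. *)
have [|P HP] := @send n s m _ i
  (fun E => [pick p : 'I_n * 'I_n | (edge p \in E) && ok p]) Q.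
  by rewrite card_option card_prod card_ord.
exists P => x sx; have [-> ->] := HP x.
case: pickP => [p /andP[pE okp]|none].
  have [K [K1K KG Kw -> bP]] := HQ (Some p) okp x sx.
  have pG : edge p \in union_graph x by apply/bigcupP; exists i.
  exists K; split=> //.
  - exact: subset_trans (subsetUr _ _) K1K.
  - apply: (subset_trans KG); rewrite -setUA subUset sub1set inE pG orbT /=.
    exact: subxx.
  - have := PhiD K1 _ K01 (card_edge _ okp) (proj2 (andP okp)); move: bP.
    rewrite -[size (i :: r)]/((size r).+1) => bP PhiK1.
    rewrite -addnA; apply: leq_trans (leq_add (leqnn m) bP) _.
    by rewrite addnA leq_add2r -mulnS leq_mul2l -addnS leq_add2l PhiK1 orbT.
have [K [K1K KG Kw -> bP]] := HQ None x sx.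
exists K; split=> //; last by move: bP => /=; nia.
move=> j e; rewrite inE => /predU1P[->|jr]; last exact: Kw.
(* An edge of site [i] wanted at the end was already wanted when [i] passed, since posting can only
   make edges unwanted. *)
move=> ei; apply/negP => wK.
have /cards2P[u [v [uv euv]]] : #|e| == 2 by rewrite (sx i).
have := none (u, v); rewrite /ok /edge /= -euv ei uv /=.
by rewrite (wantS _ _ _ K1K wK).
Qed.

(** * Posting the edges at low-degree vertices *)

Lemma low_degree_protocol (n s d m : nat) (next : edge_set n -> protocol n s) :
  n * n < 2 ^ m ->
  exists P : protocol n s, forall x, (forall i, simple_edges (x i)) ->
    exists F : edge_set n, [/\ F \subset union_graph x,
      forall u v, adj (union_graph x) u v -> ~~ adj F u v -> d <= #|nbr F u|,
      output P x = output (next F) x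
      & size (blackboard P x)
          <= m * (s + n * d) + size (blackboard (next F) x)].
Proof.
move=> nm.
pose want (K : edge_set n) (e : {set 'I_n}) :=
  (e \notin K) && [exists v in e, #|nbr K v| < d].
(* The total degree missing below [d]: initially [n * d], and lowered by each new edge that has an
   endpoint of degree below [d]. *)
pose Phi (K : edge_set n) := \sum_(v < n) (d - #|nbr K v|).
have nbrS (K K' : edge_set n) v : K \subset K' -> nbr K v \subset nbr K' v.
  by move=> KK'; apply/subsetP => w; rewrite !inE; exact: adjS.
have PhiD (K : edge_set n) (e : {set 'I_n}) :
    set0 \subset K -> #|e| = 2 -> want K e -> Phi (e |: K) < Phi K.
  move=> _ /eqP/cards2P[a [b [ab eab]]] /andP[eK /existsP[v /andP[ve dv]]].
  have [w evw] : exists w, e = [set v; w].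
    move: ve; rewrite eab !inE => /orP[/eqP->|/eqP->]; first by exists b.
    by exists a; rewrite setUC.
  have KeK : K \subset e |: K by exact: subsetUr.
  rewrite /Phi (bigD1 v) //= [X in _ < X](bigD1 v) //= -addSn leq_add //.
    apply: ltn_sub2l => //; apply: proper_card; rewrite properE nbrS //=.
    apply/subsetPn; exists w; rewrite inE /adj -evw ?setU11 //.
  by apply: leq_sum => u _; rewrite leq_sub2l // subset_leq_card // nbrS.
have wantS (K K' : edge_set n) (e : {set 'I_n}) :
    K \subset K' -> want K' e -> want K e.
  move=> KK' /andP[eK' /existsP[v /andP[ve dv]]]; apply/andP; split.
    by apply: contra eK'; exact: subsetP.
  apply/existsP; exists v; rewrite ve /=.
  by apply: leq_ltn_trans dv; rewrite subset_leq_card // nbrS.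
have [P HP] := auction next nm PhiD wantS.
exists P => x sx; have [F [_ FG Fw oP bP]] := HP x sx.
rewrite set0U in FG.
exists F; split=> //.
  move=> u v uvG uvF; have := Fw _ uvG; rewrite /want (negbTE uvF : _ \in F = false) /=.
  by move=> /existsPn/(_ u); rewrite !inE eqxx /= -leqNgt.
have -> : n * d = Phi set0.
  rewrite /Phi (eq_bigr (fun _ => d)) ?sum_nat_const ?card_ord // => v _.
  rewrite (_ : nbr _ _ = set0) ?cards0 ?subn0 //.
  by apply/setP => w; rewrite !inE /adj in_set0.
by apply: leq_trans bP; exact: leq_addr.
Qed.

(** * Dominating the high-degree vertices *)

(* Greedy choice: some vertex dominates at least a [d / n] fraction of the
   vertices that are not dominated yet. *)
Lemma greedy_domination (n d k : nat) (F : edge_set n) : d <= n ->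
  exists2 D : {set 'I_n}, #|D| <= k &
    #|[set v | (d <= #|nbr F v|) && [forall c in D, ~~ adj F v c]]| * n ^ k
      <= n * (n - d) ^ k.
Proof.
move=> dn; have [n0|n_gt0] := posnP n.
  exists set0; rewrite ?cards0 // (leq_trans (leq_mul (max_card _) (leqnn _))) //.
  by rewrite card_ord n0.
elim: k => [|k [D Dk HD]].
  exists set0; rewrite ?cards0 // !expn0 !muln1.
  by rewrite (leq_trans (max_card _)) ?card_ord.
set U := [set v | _] in HD.
(* Averaging: the pairs of a vertex of [U] and a neighbour number at least [#|U| * d], so some [w]
   takes part in at least a fraction [1 / n] of that. *)
have [w Hw] : exists w : 'I_n, #|U| * d <= #|[set v in U | adj F v w]| * n.
  apply/not_existsP => Hno.
  have : n * (\sum_(w < n) #|[set v in U | adj F v w]|).+1 <= n * (#|U| * d).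
    have -> : n * (#|U| * d) = \sum_(w < n) #|U| * d.
      by rewrite sum_nat_const card_ord.
    rewrite mulnS big_distrr /= -[X in X + _]card_ord -sum1_card -big_split /=.
    apply: leq_sum => w _; rewrite add1n mulnC ltnNge.
    by apply/negP; exact: Hno.
  rewrite leq_pmul2l // ltnNge => /negP; apply.
  have -> : \sum_(w < n) #|[set v in U | adj F v w]| =
      \sum_(w < n) \sum_(v in U) adj F v w.
    apply: eq_bigr => w _; rewrite -sum1_card big_mkcond [RHS]big_mkcond /=.
    by apply: eq_bigr => v _; rewrite [in LHS]in_set; case: (v \in U); case: adj.
  rewrite -sum_nat_const.
  rewrite exchange_big /=; apply: leq_sum => v; rewrite inE => /andP[dv _].
  apply: leq_trans dv _; rewrite -sum1_card big_mkcond /=.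
  by apply: leq_sum => w _; rewrite inE; case: adj.
exists (w |: D); first by rewrite cardsU1; case: (w \notin D); lia.
set U' := [set v | _].
have : #|U'| + #|[set v in U | adj F v w]| <= #|U|.
  rewrite -cardsUI [X in _ + X](_ : _ = 0) ?addn0.
    apply: subset_leq_card; apply/subsetP => v; rewrite !inE.
    move=> /orP[/andP[-> /forallP vD]|/andP[]//]; apply/forallP => c.
    by apply/implyP => cD; apply: (implyP (vD c)); rewrite inE cD orbT.
  apply/eqP; rewrite cards_eq0; apply/eqP/setP => v; rewrite !inE.
  apply/negP => /andP[/andP[_ /forallP/(_ w)]]; rewrite !inE eqxx /=.
  by move=> /negbTE->; rewrite andbF.
move: (#|U'|) (#|[set v in U | adj F v w]|) (#|U|) Hw HD => a b c Hb Hc ab.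
rewrite !expnS; have : a * n <= c * (n - d) by nia.
move=> /(leq_mul (leqnn (n ^ k))); nia.
Qed.

(** A block of [n %/ d + 1] greedy choices at least halves the bound on the undominated vertices,
    and [trunc_log 2 n + 1] halvings bring it from [n] to below 1. *)
Lemma domination (n d : nat) (F : edge_set n) : 0 < d -> exists D : {set 'I_n},
  #|D| <= (n %/ d).+1 * (trunc_log 2 n).+1 /\
  forall v, d <= #|nbr F v| -> exists2 c, c \in D & adj F v c.
Proof.
move=> d_gt0; set q := (n %/ d).+1; set t := (trunc_log 2 n).+1.
have [nd|dn] := ltnP n d.
  exists set0; rewrite cards0; split=> // v /(leq_trans nd).
  by rewrite ltnNge (leq_trans (max_card _)) ?card_ord.
have [D Dk HD] := greedy_domination (q * t) F dn.
exists D; split=> // v dv; apply: contrapT => noc.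
have n_gt0 : 0 < n by exact: leq_trans dn.
have half : 2 * (n - d) ^ q <= n ^ q.
  have qd : n <= q * d by rewrite /q ltnW // ltn_ceil.
  have {2}-> : n = (n - d) + d by rewrite subnK.
  move: (n - d) (leq_subr d n : n - d <= n) => e en.
  (* Bernoulli's inequality for [(1 + d / e) ^ j.+1], cleared of denominators. *)
  have bern j : e ^ j.+1 + j.+1 * d * e ^ j <= (e + d) ^ j.+1.
    elim: j => [|j IHj]; first by rewrite !expn1 expn0; lia.
    rewrite [X in _ <= X]expnS; apply: leq_trans (leq_mul (leqnn _) IHj).
    by rewrite !expnS; nia.
  apply: leq_trans (bern _); rewrite -/q mul2n -addnn leq_add2l expnS leq_mul2r.
  by rewrite (leq_trans en) ?orbT.
have halfs : 2 ^ t * (n - d) ^ (q * t) <= n ^ (q * t).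
  by rewrite !expnM -expnMn leq_exp2r.
have : n * (n - d) ^ (q * t) < n ^ (q * t).
  have [->|e_gt0] := posnP ((n - d) ^ (q * t)); first by rewrite muln0 expn_gt0 n_gt0.
  by apply: leq_trans halfs; rewrite ltn_pmul2r // trunc_log_ltn.
rewrite ltnNge => /negP; apply; apply: leq_trans HD; apply: leq_pmull.
apply/card_gt0P; exists v; rewrite !inE dv /=; apply/forallP => c.
by apply/implyP => cD; apply/negP => vc; apply: noc; exists c.
Qed.

(** * Parallel breadth-first searches *)

(* [hop_ball] grows from radius [k - 1] to radius [k] by [frontier], the sphere of
   vertices at distance exactly [k - 1]. *)
Definition frontier (n : nat) (E : edge_set n) (c : 'I_n) (k : nat) : {set 'I_n} :=
  (hop_ball E c k :\: hop_ball E c k.-1)%SET.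

(** For [K \subset G] the reverse inclusion is automatic, so this says that [K] and [G] have the
    same balls around [c] up to radius [k]. *)
Definition exact_upto (n : nat) (K G : edge_set n) (c : 'I_n) (k : nat) : Prop :=
  forall j, j <= k -> hop_ball G c j \subset hop_ball K c j.

(** Three consecutive balls are added so that the increment from [k.-1] to [k] telescopes to the
    vertices at distances [k - 2] to [k], which include all neighbours of a vertex at distance
    [k - 1]. Each vertex is counted at most three times. *)
Definition volume (n : nat) (G : edge_set n) (c : 'I_n) (k : nat) : nat :=
  #|hop_ball G c k.+1| + #|hop_ball G c k| + #|hop_ball G c k.-1|.

Lemma volume_mono (n : nat) (G : edge_set n) (c : 'I_n) (j k : nat) :
  j <= k -> volume G c j <= volume G c k.
Proof.
by move=> jk; rewrite !leq_add // subset_leq_card // hop_ball_mono //; lia.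
Qed.

Lemma volume_le (n : nat) (G : edge_set n) (c : 'I_n) (k : nat) :
  volume G c k <= 3 * n.
Proof.
have cardn (A : {set 'I_n}) : #|A| <= n by rewrite (leq_trans (max_card _)) ?card_ord.
by rewrite !mulSn mul0n addn0 addnA !leq_add.
Qed.

(** Suppose that [G] leaves the ball of radius [k] along [uv]. If [uv] is in [F], then [K] can
    follow it. Otherwise [u] has high degree and hence is not on the frontier; it lies in the
    smaller ball, so [v] was reached one radius earlier. *)
Lemma exact_skip (n d : nat) (F K G : edge_set n) (c : 'I_n) (j k : nat) :
  F \subset K -> K \subset G ->
  (forall u v, adj G u v -> ~~ adj F u v -> d <= #|nbr F u|) ->
  0 < j <= k -> exact_upto K G c j ->
  (forall i h, j <= i < k -> h \in frontier K c i -> #|nbr F h| < d) ->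
  exact_upto K G c k.
Proof.
move=> FK KG Fhi + exj; elim: k => [|k IH] jk low.
  by move: jk => /andP[/leq_trans h /h].
have [kj|jk'] := leqP k.+1 j.
  by move=> i ik; apply: exj; exact: leq_trans kj.
have exk : exact_upto K G c k.
  by apply: IH => [|i h ik]; [lia | apply: low; lia].
move=> i; rewrite leq_eqVlt => /predU1P[->{i}|/exk //].
apply/subsetP => v /hop_ball_succ[->|[u uG uv]]; first exact: hop_ball_center.
have uK := subsetP (exk k (leqnn k)) _ uG.
have [uF|/negP] := boolP (adj F u v).
  by apply: hop_ball_adj uK _; exact: adjS FK uF.
move=> /negP uF; have hu := Fhi _ _ uv uF.
have uK' : u \in hop_ball K c k.-1.
  apply/negPn/negP => uK'; have uf : u \in frontier K c k by rewrite inE uK uK'.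
  have kk : j <= k < k.+1 by rewrite ltnSn andbT -ltnS.
  by have := low k u kk uf; rewrite ltnNge hu.
have k_gt0 : 0 < k by lia.
apply: subsetP (hop_ball_mono K c (leqnSn k)) _ _; apply: subsetP (exk k (leqnn k)) _ _.
rewrite -(prednK k_gt0); apply: hop_ball_adj uv.
exact: subsetP (hop_ball_subgraph _ _ KG) _ uK'.
Qed.

(* A high-degree vertex at distance [k - 1] has all its neighbours at distance
   at least [k - 2] and at most [k]. *)
Lemma volume_growth (n d : nat) (F K G : edge_set n) (c h : 'I_n) (k : nat) :
  F \subset G -> K \subset G -> exact_upto K G c k ->
  h \in frontier K c k -> d <= #|nbr F h| ->
  volume G c k.-1 + d <= volume G c k.
Proof.
move=> FG KG exk; rewrite inE => /andP[hK' hK] dh.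
have k_gt0 : 0 < k by case: k hK {exk hK'} => // /[!hop_ball0] /[!inE].
suff : #|hop_ball G c k.-2| + #|nbr F h| <= #|hop_ball G c k.+1|.
  by rewrite /volume prednK //; lia.
rewrite -cardsUI [X in _ + X](_ : _ = 0) ?addn0.
  rewrite subset_leq_card // subUset hop_ball_mono ?andTb; last by lia.
  apply/subsetP => w; rewrite inE => /(adjS FG); apply: hop_ball_adj.
  exact: subsetP (hop_ball_subgraph _ _ KG) _ hK.
apply/eqP; rewrite cards_eq0; apply/eqP/setP => w; rewrite [LHS]inE in_set0.
apply/negP => /andP[wG]; rewrite inE => /(adjS FG); rewrite adjC => wh.
(* A neighbour [w] of [h] within radius [k - 2] would put [h] within radius [k - 1], off the
   frontier; for [k = 1] the inner ball is empty. *)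
case: k k_gt0 exk hK' wG {hK} => [//|[|k]] _ exk hK' /=; first by rewrite hop_ball0 inE.
move=> wG; move/negP: hK'; apply; apply: subsetP (exk _ _) _ _ => //.
exact: hop_ball_adj wh.
Qed.

(** The next level that needs communication. The cap [M] makes the minimum exist even if no later
    frontier meets a high-degree vertex. *)
Lemma next_radius (n d M : nat) (F K : edge_set n) (c : 'I_n) (k : nat) :
  exists k', [/\ k < k',
    forall i h, k < i < k' -> h \in frontier K c i -> #|nbr F h| < d
    & M <= k' \/ exists2 h, h \in frontier K c k' & d <= #|nbr F h|].
Proof.
pose P j := (k < j) && ((M <= j) || [exists h in frontier K c j, d <= #|nbr F h|]).
have exP : exists j, P j.
  by exists (maxn M k.+1); rewrite /P leq_maxl leq_maxr.
case: (ex_minnP exP) => k' /andP[kk' stop] mink'; exists k'; split=> //.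
  move=> i h /andP[ki ik'] hi; rewrite ltnNge; apply/negP => dh.
  suff : k' <= i by rewrite leqNgt ik'.
  by apply: mink'; rewrite /P ki; apply/orP; right; apply/existsP; exists h; rewrite hi.
by move: stop => /orP[|/existsP[h /andP[? ?]]]; [left | right; exists h].
Qed.

(** Here [t] of [T] rounds remain. Every center has either reached radius [M] or gained volume [d]
    per past round; since the volume is at most [3 * n < T * d], all centers are finished when
    [t = 0]. Each posted edge is charged to a center and a vertex that it newly reaches. *)
Lemma bfs_protocol (n s d m M t : nat) (F : edge_set n) (D : {set 'I_n})
    (T : nat) :
  n * n < 2 ^ m -> t <= T -> 3 * n < T * d ->
  forall (K0 : edge_set n) (r : 'I_n -> nat),
  exists P : protocol n s, forall x, (forall i, simple_edges (x i)) ->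
    F \subset K0 -> K0 \subset union_graph x ->
    (forall u v, adj (union_graph x) u v -> ~~ adj F u v -> d <= #|nbr F u|) ->
    (forall c, c \in D -> exact_upto K0 (union_graph x) c (r c)) ->
    (forall c, c \in D ->
       M <= r c \/ (T - t) * d <= volume (union_graph x) c (r c)) ->
    [/\ K0 \subset output P x, output P x \subset union_graph x,
      forall c, c \in D -> exact_upto (output P x) (union_graph x) c M
      & size (blackboard P x)
          <= m * (t * s + \sum_(c in D) #|~: hop_ball K0 c (r c).+1|)].
Proof.
move=> nm + Td; elim: t => [|t IH] tT K0 r.
  exists (Output s K0) => x sx FK KG Fhi ex vol; split=> // c cD j jM.
  apply: ex => //; apply: leq_trans jM _.
  case: (vol c cD) => //; rewrite subn0 => /leq_trans/(_ (volume_le _ _ _)).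
  by rewrite leqNgt Td.
(* The next radii are functions of the posted edges alone, so the protocol tree can branch on
   them. *)
have /choice[nxt nxtP] (K : edge_set n) : exists r' : 'I_n -> nat, forall c,
    [/\ r c < r' c,
    forall i h, r c < i < r' c -> h \in frontier K c i -> #|nbr F h| < d
    & M <= r' c \/ exists2 h, h \in frontier K c (r' c) & d <= #|nbr F h|].
  have /choice[f Hf] c := next_radius d M F K c (r c).
  by exists f.
have /choice[Q HQ] (K : edge_set n) := IH (ltnW tT) K (nxt K).
(* The inner ball is taken in [K0], frozen for the round, so that posting can only make edges
   unwanted. *)
pose want (K : edge_set n) (e : {set 'I_n}) :=
  [exists c in D, exists u in hop_ball K0 c (r c),
   exists v, (v \notin hop_ball K c (r c).+1) && (e == [set u; v])].
pose Phi (K : edge_set n) := \sum_(c in D) #|~: hop_ball K c (r c).+1|.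
have PhiD (K : edge_set n) (e : {set 'I_n}) :
    K0 \subset K -> #|e| = 2 -> want K e -> Phi (e |: K) < Phi K.
  move=> K0K _ /existsP[c /andP[cD /existsP[u /andP[uK /existsP[v]]]]].
  move=> /andP[vK /eqP euv].
  have KeK : K \subset e |: K by exact: subsetUr.
  rewrite /Phi (bigD1 c) //= [X in _ < X](bigD1 c) //= -addSn leq_add //.
    apply: proper_card; rewrite properE setCS hop_ball_subgraph //=.
    apply/subsetPn; exists v; rewrite !in_setC // negbK.
    apply: (@hop_ball_adj _ _ _ u); last by rewrite /adj -euv setU11.
    by apply: subsetP (hop_ball_subgraph _ _ _) _ uK; exact: subset_trans KeK.
  by apply: leq_sum => c' _; rewrite subset_leq_card // setCS hop_ball_subgraph.
have wantS (K K' : edge_set n) (e : {set 'I_n}) :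
    K \subset K' -> want K' e -> want K e.
  move=> KK' /existsP[c /andP[cD /existsP[u /andP[uK /existsP[v]]]]].
  move=> /andP[vK /eqP euv].
  apply/existsP; exists c; rewrite cD; apply/existsP; exists u; rewrite uK.
  apply/existsP; exists v; rewrite euv eqxx andbT; apply: contra vK.
  exact: subsetP (hop_ball_subgraph _ _ KK') _.
have [P HP] := auction Q nm PhiD wantS.
exists P => x sx FK0 K0G Fhi ex vol; have [K [K0K KG Kw -> bP]] := HP x sx.
have {}KG : K \subset union_graph x.
  by apply: subset_trans KG _; rewrite subUset K0G subxx.
have FK := subset_trans FK0 K0K.
set G := union_graph x in ex vol Fhi Kw KG K0G *.
(* The round advances every center by one level: an edge to a vertex still unreached would be
   wanted. *)
have exS c : c \in D -> exact_upto K G c (r c).+1.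
  move=> cD j; rewrite leq_eqVlt => /predU1P[->{j}|jr]; last first.
    by apply: subset_trans (ex c cD j jr) _; exact: hop_ball_subgraph.
  apply/subsetP => v /hop_ball_succ[->|[u uG uv]]; first exact: hop_ball_center.
  apply/negPn/negP => vK; move/negP: (Kw _ uv); apply.
  apply/existsP; exists c; rewrite cD; apply/existsP; exists u.
  rewrite (subsetP (ex c cD _ (leqnn _)) _ uG) /=.
  by apply/existsP; exists v; rewrite vK eqxx.
have exN c : c \in D -> exact_upto K G c (nxt K c).
  move=> cD; have [lt low _] := nxtP K c.
  by apply: (exact_skip FK KG Fhi _ (exS c cD)) => //; rewrite lt.
have volN c : c \in D -> M <= nxt K c \/ (T - t) * d <= volume G c (nxt K c).
  move=> cD; have [lt low [|[h hf dh]]] := nxtP K c; first by left.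
  case: (vol c cD) => [Mr|vr]; first by left; lia.
  right; have := volume_growth (subset_trans FK KG) KG (exN c cD) hf dh.
  apply: leq_trans; have -> : T - t = (T - t.+1).+1 by lia.
  rewrite mulSn addnC leq_add2r (leq_trans vr) // volume_mono //; lia.
have [KO OG exO bQ] := HQ K x sx FK KG Fhi exN volN.
split=> //; first exact: subset_trans KO.
have := leq_add bP bQ; rewrite -/(Phi K0) => {bP bQ} b.
(* The balls only grow with the radius, so the potential left over by this round pays for the later
   ones. *)
have PhiN : \sum_(c in D) #|~: hop_ball K c (nxt K c).+1| <= Phi K.
  apply: leq_sum => c _; rewrite subset_leq_card // setCS hop_ball_mono //.
  by have [lt _ _] := nxtP K c; rewrite ltnS ltnW.
have := leq_mul (leqnn m) PhiN; move: b; rewrite mulSn.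
move: (Phi K) (Phi K0) (\sum_(c in D) _) (size _) (size _) => a b c e f.
rewrite !mulnDr; lia.
Qed.

(** * Stretch and cost of the protocol *)

(** Split the path at the tail of its first edge outside [F]; this vertex has a center [c] as a
    neighbour. In [K], both ends are as close to [c] as in [G], at most one step more than the
    length of their part of the path. *)
Lemma additive2_paths (n d : nat) (F K G : edge_set n) (D : {set 'I_n})
    (u : 'I_n) (p : seq 'I_n) :
  F \subset K ->
  (forall u v, adj G u v -> ~~ adj F u v -> d <= #|nbr F u|) ->
  (forall v, d <= #|nbr F v| -> exists2 c, c \in D & adj F v c) ->
  (forall c, c \in D -> exact_upto K G c n.+1) ->
  F \subset G -> path (adj G) u p ->
  exists q, [/\ path (adj K) u q, last u q = last u p & size q <= size p + 2].
Proof.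
(* A path without repetition has fewer than [n] edges, which keeps both walks from the center within
   the exact radius [n.+1]. *)
move=> FK Fhi dom ex FG /shortenP[p' pp' up' /(uniq_leq_size (proj2 (andP up'))) sp].
suff [q [pq lq sq]] : exists q,
    [/\ path (adj K) u q, last u q = last u p' & size q <= size p' + 2].
  by exists q; split=> //; rewrite (leq_trans sq) // leq_add2r.
have sizep' : size p' < n.
  by have := max_card (mem (u :: p')); rewrite (card_uniqP up') card_ord.
have [/(@sub_path _ _ (adj K)) pF|] := boolP (path (adj F) u p').
  by exists p'; rewrite leq_addr pF // => a b; exact: adjS.
move=> notF.
have [p1 [p2 [def_p hi]]] : exists p1 p2,
    p' = p1 ++ p2 /\ d <= #|nbr F (last u p1)|.
  elim: p' u pp' notF {up' sp sizep'} => //= v p' IH u /andP[uv pp'].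
  rewrite negb_and; have [uvF /= nF|/(Fhi _ _ uv) du _] := boolP (adj F u v).
    by have [p1 [p2 [-> hi]]] := IH v pp' nF; exists (v :: p1), p2.
  by exists [::], (v :: p').
move: pp' sizep' {up' sp notF}; rewrite {}def_p cat_path size_cat last_cat.
move=> /andP[pp1 pp2] sz; have [c cD xc] := dom _ hi.
move: (adjS FG xc); rewrite adjC => cx.
have [q1 [pq1 lq1 sq1]] : exists q, [/\ path (adj K) c q, last c q = u &
    size q < (size p1).+2].
  have [p1' [pp1' lp1' sp1']] := path_adj_rev pp1.
  apply/hop_ballP; apply: subsetP (ex c cD _ _) _ _; first by lia.
  by apply/hop_ballP; exists (last u p1 :: p1'); rewrite /= cx pp1' sp1'.
have [q2 [pq2 lq2 sq2]] : exists q, [/\ path (adj K) c q,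
    last c q = last (last u p1) p2 & size q < (size p2).+2].
  apply/hop_ballP; apply: subsetP (ex c cD _ _) _ _; first by lia.
  by apply/hop_ballP; exists (last u p1 :: p2); rewrite /= cx pp2.
have := path_adj_rev pq1; rewrite lq1 => -[q [pq lq sq]].
exists (q ++ q2); rewrite cat_path pq lq pq2 last_cat lq size_cat; split=> //; lia.
Qed.

Lemma spanner_protocol (n s d : nat) : 0 < d -> n + s <= d ^ 2 ->
  exists P : protocol n s, forall x, (forall i, simple_edges (x i)) ->
    [/\ output P x \subset union_graph x,
      forall u p, path (adj (union_graph x)) u p -> exists q,
        [/\ path (adj (output P x)) u q, last u q = last u p
          & size q <= size p + 2]
      & size (blackboard P x) <= 14 * (trunc_log 2 n).+1 ^ 2 * (s + n * d)].
Proof.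
move=> d_gt0 nsd; set t := (trunc_log 2 n).+1; pose m := 2 * t.
have nm : n * n < 2 ^ m.
  by rewrite /m mulnC expnM expnS expn1 ltn_mul // trunc_log_ltn.
pose T := (3 * n %/ d).+1.
have Td : 3 * n < T * d by rewrite ltn_ceil.
have /choice[D HD] (F : edge_set n) := domination F d_gt0.
have /choice[Q HQ] (F : edge_set n) :=
  @bfs_protocol n s d m n.+1 T F (D F) T nm (leqnn T) Td F (fun=> 0).
have [P HP] := low_degree_protocol d Q nm.
exists P => x sx; have [F [FG Fhi -> bP]] := HP x sx.
have [||FK KG ex bQ] := HQ F x sx (subxx _) FG Fhi.
- by move=> c _ j; rewrite leqn0 => /eqP->; rewrite hop_ball0 sub0set.
- by move=> c _; right; rewrite subnn.
have [Dt dom] := HD F.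
split=> // [u p|]; first exact: additive2_paths FK Fhi dom ex FG.
apply: leq_trans bP _; apply: leq_trans (leq_add (leqnn _) bQ) _.
rewrite -mulnDr.
have : \sum_(c in D F) #|~: hop_ball F c 1| <= #|D F| * n.
  rewrite -sum_nat_const; apply: leq_sum => c _.
  by rewrite (leq_trans (max_card _)) ?card_ord.
move/leq_trans/(_ (leq_mul Dt (leqnn n))); rewrite -/t.
set S := \sum_(c in _) _; set q := (n %/ d).+1 => Sq.
have T3 : T <= 3 * q by rewrite ltn_divLR // -mulnA ltn_pmul2l // ltn_ceil.
have nd : n <= n * d by rewrite leq_pmulr.
(* The choice of [d] enters here: [(n %/ d) * (n + s) <= (n %/ d) * d ^ 2 <= n * d]. *)
have qns : q * (n + s) <= n * d + (n + s).
  rewrite mulSn addnC leq_add2r; apply: leq_trans (leq_mul (leqnn _) nsd) _.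
  by rewrite expnS expn1 mulnA leq_mul2r leq_divM orbT.
have Ts : T * s <= 3 * (q * s) by rewrite mulnA leq_mul2r T3 orbT.
have t_gt0 : 0 < t by [].
(* A message takes [2 * t] bits and the number of centers brings another factor [t]. What remains is
   at most [4 * s + 4 * n * d + 3 * n], hence the factor 7. *)
rewrite /m -mulnA expnS expn1 (_ : 14 = 2 * 7) // -!mulnA leq_mul2l /=.
rewrite [7 * _]mulnCA leq_mul2l; apply/orP; right.
have : S <= t * (q * n) by rewrite mulnA (mulnC t).
have le_t a b : a <= b -> a <= t * b by move=> /leq_trans; apply; exact: leq_pmull.
have : s + n * d + T * s <= t * (s + n * d + 3 * (q * s)).
  by apply: le_t; rewrite leq_add2l.
move=> h1 h2; apply: leq_trans (_ : _ <= t * (s + n * d + 3 * (q * s) + q * n)) _.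
  by rewrite mulnDr addnA leq_add.
rewrite [7 * _]mulnCA leq_mul2l; apply/orP; right.
by move: qns; rewrite mulnDr; lia.
Qed.

(** * Distances and the asymptotic bound *)

Local Open Scope ring_scope.

Lemma additive_spanner_paths (R : realType) (beta n : nat) (G H : edge_set n) :
  H \subset G ->
  (forall u p, path (adj G) u p -> exists q,
    [/\ path (adj H) u q, last u q = last u p & (size q <= size p + beta)%N]) ->
  additive_spanner R beta G H.
Proof.
move=> HG Hpath; split=> // u v.
rewrite -leeBlDr //; apply: le_ereal_inf_tmp => _ [p [pp lp] <-].
have [q [pq lq sq]] := Hpath u p pp.
rewrite leeBlDr // -EFinD -natrD.
apply: le_trans (_ : ((size q)%:R%:E <= _)%E); last by rewrite lee_fin ler_nat.
by apply: ereal_inf_lbound; exists q => //; rewrite -lp.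
Qed.

Theorem theorem10 (R : realType) (dup : bool) :
  soft_O (fun n s : nat => spanner_complexity R 2 dup n s)
         (fun n s : nat => s%:R + n%:R * Num.sqrt (n%:R + s%:R)).
Proof.
have ln2_gt0 : 0 < ln 2 :> R by rewrite ln_gt0 // ltr1n.
(* A factor 2 on top of 14 comes from rounding the square root up to [d], and each of the two
   logarithmic factors costs [2 / ln 2]. *)
exists (28 * (2 / ln 2) ^+ 2), 2 => n s.
set rt := Num.sqrt _; set g := _ + _.
have rt_ge0 : 0 <= rt by exact: sqrtr_ge0.
have rtE : rt ^+ 2 = n%:R + s%:R by rewrite sqr_sqrtr // addr_ge0.
have g_ge0 : 0 <= g by rewrite addr_ge0 // mulr_ge0.
pose d := (Num.truncn rt).+1.
have rtd : rt <= d%:R by rewrite ltW // truncnS_gt.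
have nsd : (n + s <= d ^ 2)%N.
  by rewrite -(ler_nat R) natrD natrX -rtE lerXn2r ?nnegrE.
have [P HP] := spanner_protocol (ltn0Sn _) nsd.
set c := (14 * _ * _)%N in HP.
have simple (x : distributed_input n s) : valid_input dup x ->
  forall i, simple_edges (x i) by case.
apply: (@le_trans _ _ (c%:R)%:E).
  apply: ereal_inf_lbound; exists c => //; exists P; split=> x vx.
    by have [HG Hp _] := HP x (simple x vx); exact: additive_spanner_paths.
  by have [_ _] := HP x (simple x vx).
rewrite lee_fin.
(* The root is at least 1 as soon as [n] is positive. *)
have nrt : n%:R <= n%:R * rt.
  case: n @rt @g rt_ge0 rtE {g_ge0 d rtd nsd P HP c simple} => [|n] rt g rt_ge0 rtE.
    by rewrite !mul0r.
  rewrite ler_peMr // -(@ler_pXn2r _ 2) ?nnegrE // rtE expr1n.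
  by rewrite -natrD ler1n.
have snd : (s + n * d)%:R <= 2 * g.
  have : d%:R <= rt + 1 by rewrite -natr1 lerD2r truncn_le.
  move/(ler_wpM2l (ler0n R n)); rewrite natrD natrM /g.
  have : 0 <= s%:R :> R by []; move: nrt; lra.
have ln_ge u : 0 < u -> u <= g + 2 -> ln u <= ln (g + 2).
  by move=> u0 ug; rewrite ler_ln // posrE ltr_wpDl.
(* Both [trunc_log 2 n * ln 2] and the [ln 2] from the successor are at most [ln (g + 2)]. *)
have tg : (trunc_log 2 n).+1%:R <= 2 / ln 2 * ln (g + 2).
  rewrite mulrAC ler_pdivlMr // -natr1 mulrDl mul1r.
  have : ln 2 <= ln (g + 2) by apply: ln_ge => //; rewrite lerDr.
  suff : (trunc_log 2 n)%:R * ln 2 <= ln (g + 2) by lra.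
  rewrite mulr_natl -lnXn //; apply: ln_ge; first by rewrite exprn_gt0.
  have [->|n_gt0] := posnP n; first by rewrite trunc_log0 expr0; move: g_ge0; lra.
  have : (2 ^ trunc_log 2 n)%:R <= n%:R :> R by rewrite ler_nat trunc_logP.
  rewrite natrX => /le_trans; apply; apply: le_trans nrt _.
  by rewrite /g; have : 0 <= s%:R :> R by []; lra.
rewrite /c natrM natrM natrX.
have -> : 28 * (2 / ln 2) ^+ 2 * g * ln (g + 2) ^+ 2 =
    14 * (2 / ln 2 * ln (g + 2)) ^+ 2 * (2 * g) by ring.
rewrite ler_pM // ?mulr_ge0 // ?exprn_ge0 // ler_wpM2l //.
by rewrite lerXn2r ?nnegrE // (le_trans _ tg).
Qed.
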